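(* Let $\mu$ be the Gibbs distribution of a $q$-state spin system, let $\kappa\in(0,1)$ and $\gamma\ge1$. If $\mu$ is $\kappa$-contractive with respect to arbitrary select-update dynamics and an arbitrary $\gamma$-equivalent metric, then $\mu$ is spectrally independent with constant $$\eta=\frac{2\gamma^2DM}{1-\kappa},$$ where $M$ is the maximum block size and $D$ is the maximum probability of a vertex being selected in any step of the dynamics.
   Context: Spin system. Let $q\ge2$, $[q]=\{1,\dots,q\}$, and let $G=(V\cup\partial V,E\cup\partial E)$ be a finite graph, where $\partial V$ is a (possibly empty) boundary set, $E$ is the set of edges inside $V$ and $\partial E$ the set of edges between $V$ and $\partial V$. Given nonnegative symmetric matrices $A_{xy}\in\mathbb R_+^{q\times q}$ for $\{x,y\}\in E\cup\partial E$, vectors $B_x\in\mathbb R_+^q$ for $x\in V$, and a boundary condition $\xi\in[q]^{\partial V}$, a configuration $\sigma\in[q]^V$ has weight $w(\sigma)=\prod_{\{x,y\}\in E}A_{xy}(\sigma_x,\sigma_y)\prod_{\{x,y\}\in\partial E,\,x\in V,\,y\in\partial V}A_{xy}(\sigma_x,\xi_y)\prod_{x\in V}B_x(\sigma_x)$. Let $\Omega=\{\sigma:w(\sigma)>0\}$ (assumed nonempty); the Gibbs distribution is $\mu(\sigma)\propto w(\sigma)$ on $\Omega$. Pinnings. For $U\subset V$, $\Omega_U$ is the set of $\tau\in[q]^U$ that extend to an element of $\Omega$; $\mathcal T=\bigcup_{U\subset V}\Omega_U$. For $\tau\in\Omega_U$, $\mu^\tau=\mu(\cdot\mid\sigma_U=\tau)$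 with support $\Omega^\tau$; $\Omega_x^\tau$ is the set of spins possible at $x$ under $\mu^\tau$; $\mathcal X^\tau=\{(x,a):x\in V\setminus U,a\in\Omega^\tau_x\}$. Standing assumption: $\mu$ is totally-connected, i.e. for every pinning $\tau$ the set $\Omega^\tau$ is connected under moves between configurations at Hamming distance 1. Spectral independence. $J^\tau\in\mathbb R^{\mathcal X^\tau\times\mathcal X^\tau}$ has entries $J^\tau(x,a;x,a')=0$ and $J^\tau(x,a;y,a')=\mu^\tau(\sigma_y=a'\mid\sigma_x=a)-\mu^\tau(\sigma_y=a')$ for $x\neq y$; its eigenvalues are real. $\mu$ is spectrally independent with constant $\eta$ if $\lambda_1(J^\tau)\le\eta$ for all $\tau\in\mathcal T$, where $\lambda_1$ denotes the largest eigenvalue. Select-update dynamics. Let $\mathcal B$ be a collection of subsets (blocks) of $V$. A select-update dynamics is a family $\{P^\tau:\tau\in\mathcal T\}$, where $P^\tau$ is a Markov chain on $\Omega^\tau$ with stationary distribution $\mu^\tau$, of the following form: given the current configuration $\sigma^t\in\Omega^\tau$, (1) select a block $B\in\mathcal B$ from a distribution $p_t$ over $\mathcal B$, which may depend on $\sigma^t$ but not on the pinning $\tau$; (2) resample the configuration on $B$ from a distribution $\nu_B^t$, which may depend on the whole current configuration $\sigma^t$ and on the part of the pinning $\tau$ contained in $B$ (the configuration outside $B$ is unchanged). Define $M=\max_{B\in\mathcal B}|B|$ and $D=\max_{p_t}\max_{x\in V}\sum_{B\in\mathcal B:x\in B}p_t(B)$, the first maximum being over all selection distributions $p_t$ that can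 occur. Contraction. $\mu$ is $\kappa$-contractive w.r.t. a family $\{P^\tau\}$ and a metric $d$ on $\Omega$ if for all $\tau\in\mathcal T$ and all $X_0,Y_0\in\Omega^\tau$ there is a coupling $(X_0,Y_0)\to(X_1,Y_1)$ of one step of $P^\tau$ with $\mathbb E[d(X_1,Y_1)\mid X_0,Y_0]\le\kappa\,d(X_0,Y_0)$. A metric $d$ on $\Omega$ is $\gamma$-equivalent if $\frac1\gamma d_{\mathrm H}\le d\le\gamma d_{\mathrm H}$, where $d_{\mathrm H}(\sigma,\tau)=|\{x:\sigma_x\ne\tau_x\}|$. *)

(* Defs.v *)
From HB Require Import structures.
From mathcomp Require Import all_boot all_order all_algebra.
From mathcomp Require Import reals.

Set Implicit Arguments.
Unset Strict Implicit.
Unset Printing Implicit Defensive.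

Import Order.TTheory GRing.Theory Num.Theory.
Local Open Scope ring_scope.

Notation config q V := {ffun V -> 'I_q}.

(* A partial configuration in [q]^U, with U = [set x | t x != None]. *)
Notation partial_config q V := {ffun V -> option 'I_q}.

Section FiniteProbability.
Variables (R : realType) (T : finType).

Definition is_dist (X : {set T}) (f : T -> R) : Prop :=
  [/\ forall t, 0 <= f t, forall t, t \notin X -> f t = 0 & \sum_t f t = 1].

Definition Pr (f : T -> R) (E : pred T) : R := \sum_(t | E t) f t.

Definition cond (f : T -> R) (E : pred T) : T -> R :=
  fun t => (if E t then f t else 0) / Pr f E.

Definition is_coupling (f g : T -> R) (c : T * T -> R) : Prop :=
  [/\ forall u, 0 <= c u,
      forall s, \sum_t c (s, t) = f s
    & forall t, \sum_s c (s, t) = g t].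

Definition expect (f : T -> R) (h : T -> R) : R := \sum_t f t * h t.

Definition metric_on (X : {set T}) (d : T -> T -> R) : Prop :=
  [/\ {in X &, forall s t, 0 <= d s t},
      {in X &, forall s t, d s t = 0 <-> s = t},
      {in X &, forall s t, d s t = d t s}
    & {in X & &, forall r s t, d r t <= d r s + d s t}].

End FiniteProbability.

(* The vertex set is V, the boundary is W; the matrices interaction x y and
   binteraction x y are only meaningful on edges. *)
Record spin_system (R : realType) (q : nat) (V W : finType) := SpinSystem {
  edge : rel V;
  bedge : V -> W -> bool;
  interaction : V -> V -> 'M[R]_q;
  binteraction : V -> W -> 'M[R]_q;
  field_at : V -> 'rV[R]_q;
  boundary : {ffun W -> 'I_q};
  edge_sym : symmetric edge;
  edge_irr : irreflexive edge;
  interactionC : forall x y, edge x y -> interaction x y = interaction y x;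
  interaction_sym : forall x y, edge x y -> (interaction x y)^T = interaction x y;
  interaction_ge0 : forall x y, edge x y -> forall a b, 0 <= interaction x y a b;
  binteraction_sym : forall x y, bedge x y ->
    (binteraction x y)^T = binteraction x y;
  binteraction_ge0 : forall x y, bedge x y ->
    forall a b, 0 <= binteraction x y a b;
  field_at_ge0 : forall x a, 0 <= field_at x ord0 a
}.

Section SpinSystem.
Variables (R : realType) (q : nat) (V W : finType) (S : spin_system R q V W).

(* The comparison of ranks selects one orientation of each unordered edge; by
   interactionC and interaction_sym the value does not depend on which one. *)
Definition weight (s : config q V) : R :=
  (\prod_(e : V * V | edge S e.1 e.2 && (enum_rank e.1 < enum_rank e.2)%N)
      interaction S e.1 e.2 (s e.1) (s e.2))
  * (\prod_(e : V * W | bedge S e.1 e.2)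
      binteraction S e.1 e.2 (s e.1) (boundary S e.2))
  * (\prod_(x : V) field_at S x ord0 (s x)).

Definition Omega : {set config q V} := [set s | 0 < weight s].

Definition gibbs (s : config q V) : R := weight s / \sum_t weight t.

Definition extends (tau : partial_config q V) : pred (config q V) :=
  fun s => [forall x, (tau x == None) || (tau x == Some (s x))].

Definition Omega_pin (tau : partial_config q V) : {set config q V} :=
  [set s in Omega | extends tau s].

Definition pinning (tau : partial_config q V) : bool := Omega_pin tau != set0.

Definition gibbs_pin (tau : partial_config q V) : config q V -> R :=
  cond gibbs (extends tau).

Definition hamming (s t : config q V) : nat := #|[set x | s x != t x]|.

Definition totally_connected : Prop :=
  forall tau, pinning tau ->
  {in Omega_pin tau &, forall s t,
     connect [rel s' t' | [&& s' \in Omega_pin tau, t' \in Omega_pin tau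
                            & hamming s' t' == 1%N]] s t}.

Definition free_spins (tau : partial_config q V) : {set V * 'I_q} :=
  [set u | (tau u.1 == None) && [exists s in Omega_pin tau, s u.1 == u.2]].

Definition influence (tau : partial_config q V) (u v : V * 'I_q) : R :=
  if u.1 == v.1 then 0 else
    Pr (cond (gibbs_pin tau) (fun s => s u.1 == u.2)) (fun s => s v.1 == v.2)
    - Pr (gibbs_pin tau) (fun s => s v.1 == v.2).

Definition influence_mx (tau : partial_config q V) : 'M[R]_#|free_spins tau| :=
  \matrix_(i, j) influence tau (enum_val i) (enum_val j).

(* The largest eigenvalue is at most eta. The matrix has no eigenvalue exactly
   when free_spins tau is empty, i.e. when tau pins every vertex. *)
Definition spectrally_independent (eta : R) : Prop :=
  forall tau, pinning tau ->
  forall lambda, eigenvalue (influence_mx tau) lambda -> lambda <= eta.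

Definition restrict (tau : partial_config q V) (B : {set V}) :
    partial_config q V :=
  [ffun x => if x \in B then tau x else None].

Definition agree_off (B : {set V}) (s : config q V) : {set config q V} :=
  [set t : config q V | [forall x, (x \notin B) ==> (t x == s x)]].

(* One step of the dynamics with pinning tau: the block law select s sees the
   current configuration s only, and the update law sees s and the restriction
   of tau to the chosen block. Update laws are distributions over whole
   configurations that agree with s off the block. *)
Definition step_of (blocks : {set {set V}}) (select : config q V -> {set V} -> R)
    (update : {set V} -> config q V -> partial_config q V -> config q V -> R)
    (tau : partial_config q V) (s t : config q V) : R :=
  \sum_(B in blocks) select s B * update B s (restrict tau B) t.

Record select_update := SelectUpdate {
  blocks : {set {set V}};
  select : config q V -> {set V} -> R;
  update : {set V} -> config q V -> partial_config q V -> config q V -> R;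
  select_dist : forall s, s \in Omega -> is_dist blocks (select s);
  update_dist : forall tau, pinning tau -> forall s, s \in Omega_pin tau ->
    forall B, B \in blocks -> is_dist (agree_off B s) (update B s (restrict tau B));
  step_dist : forall tau, pinning tau -> forall s, s \in Omega_pin tau ->
    is_dist (Omega_pin tau) (step_of blocks select update tau s);
  step_stationary : forall tau, pinning tau -> forall t, t \in Omega_pin tau ->
    \sum_(s in Omega_pin tau) gibbs_pin tau s * step_of blocks select update tau s t
      = gibbs_pin tau t
}.

Definition step (P : select_update) :
    partial_config q V -> config q V -> config q V -> R :=
  step_of (blocks P) (select P) (update P).

Definition max_block_size (P : select_update) : nat :=
  \max_(B in blocks P) #|B|.

Definition max_select_prob (P : select_update) : R :=
  \big[Num.max/0]_(s in Omega) \big[Num.max/0]_(x : V)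
     \sum_(B in blocks P | x \in B) select P s B.

Definition contractive (kappa : R) (P : select_update)
    (d : config q V -> config q V -> R) : Prop :=
  forall tau, pinning tau -> {in Omega_pin tau &, forall s t,
    exists2 c : config q V * config q V -> R,
      is_coupling (step P tau s) (step P tau t) c
    & expect c (fun u => d u.1 u.2) <= kappa * d s t}.

Definition equivalent_metric (gamma : R) (d : config q V -> config q V -> R) :
    Prop :=
  metric_on Omega d /\
  {in Omega &, forall s t,
     gamma^-1 * (hamming s t)%:R <= d s t <= gamma * (hamming s t)%:R}.

End SpinSystem.

(* Main.v *)
Require Import Defs.
From HB Require Import structures.
From mathcomp Require Import all_boot all_order all_algebra.
From mathcomp Require Import reals.
From mathcomp Require classical_sets.

Set Implicit Arguments.
Unset Strict Implicit.
Unset Printing Implicit Defensive.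

Import Order.TTheory GRing.Theory Num.Theory.
Local Open Scope ring_scope.

(** Fix a pinning tau and a pair (x, a), and let mu be the Gibbs distribution
    pinned by tau and nu the one pinned in addition by the spin a at x. The
    eigenvalues of the influence matrix are at most its largest absolute row
    sum, and the row sum at (x, a) is the gap between the expectations under
    nu and mu of a sum f of signed indicators of the events that the spin at y
    is b. Such a sum is 2-Lipschitz for the Hamming distance, hence
    2 * gamma-Lipschitz for d.

    It remains to bound this gap for a function g that is 1-Lipschitz for d.
    Let P and Q be the steps of the dynamics under the two pinnings, with
    stationary laws mu and nu. Then
      nu(g) - mu(g) = nu(Q g - P g) + (nu(P g) - mu(P g)).
    By contraction P g is kappa-Lipschitz, so the second term is at most kappa
    times the largest such gap. In the first term, the two steps select the
    same block and differ only if that block contains x, which has probability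
    at most D; their outcomes then differ at no more than M vertices, where g
    varies by at most gamma * M. So every gap is at most
    gamma * D * M / (1 - kappa) ([stationary_perturbation],
    [step_pin_vertex_le]), and the factor 2 * gamma gives the theorem. *)

(** * Expectations, couplings and Lipschitz functions *)

Section Expectation.
Variables (R : realType) (T : finType).
Implicit Types (f g h : T -> R) (X : {set T}).

Lemma expect_indicator f (E : pred T) : expect f (fun t => (E t)%:R) = Pr f E.
Proof.
rewrite /expect /Pr [RHS]big_mkcond; apply: eq_bigr => t _.
by case: (E t); rewrite ?mulr1 ?mulr0.
Qed.

Lemma expectZ f (a : R) h : expect f (fun t => a * h t) = a * expect f h.
Proof. by rewrite /expect mulr_sumr; apply: eq_bigr => t _; rewrite mulrCA. Qed.

Lemma expect_sum (I : finType) f (F : I -> T -> R) :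
  expect f (fun t => \sum_i F i t) = \sum_i expect f (F i).
Proof.
rewrite /expect exchange_big; apply: eq_bigr => t _.
by rewrite mulr_sumr.
Qed.

(** Kantorovich duality, easy direction; the Lipschitz bound is only needed on a
    set X that carries both laws, since the coupling vanishes off X * X. *)
Lemma coupling_expect_le X f g (c : T * T -> R) (d : T -> T -> R) h :
    is_coupling f g c ->
    (forall s, s \notin X -> f s = 0) -> (forall t, t \notin X -> g t = 0) ->
    {in X &, forall s t, h s - h t <= d s t} ->
  expect f h - expect g h <= expect c (fun u => d u.1 u.2).
Proof.
move=> [c0 cl cr] fX gX hd.
have cfX s t : s \notin X -> c (s, t) = 0.
  move=> /fX; rewrite -cl => /eqP; rewrite psumr_eq0 // => /allP/(_ t).
  by rewrite mem_index_enum => /(_ isT)/eqP.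
have cgX s t : t \notin X -> c (s, t) = 0.
  move=> /gX; rewrite -cr => /eqP; rewrite psumr_eq0 // => /allP/(_ s).
  by rewrite mem_index_enum => /(_ isT)/eqP.
have -> : expect f h - expect g h = \sum_u c u * (h u.1 - h u.2).
  under [RHS]eq_bigr do rewrite mulrBr.
  rewrite sumrB; congr (_ - _); rewrite /expect.
    transitivity (\sum_s \sum_t c (s, t) * h s).
      by apply: eq_bigr => s _; rewrite -cl mulr_suml.
    by rewrite pair_bigA; apply: eq_bigr => -[].
  transitivity (\sum_s \sum_t c (s, t) * h t).
    by rewrite exchange_big; apply: eq_bigr => t _; rewrite -cr mulr_suml.
  by rewrite pair_bigA; apply: eq_bigr => -[].
apply: ler_sum => -[s t] _ /=.
have [sX|/cfX->] := boolP (s \in X); last by rewrite !mul0r.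
have [tX|/cgX->] := boolP (t \in X); last by rewrite !mul0r.
by apply: ler_wpM2l; rewrite ?c0 ?hd.
Qed.

Lemma expect_oscillation_le X f g h (C : R) :
    is_dist X f -> is_dist X g -> {in X &, forall s t, h s - h t <= C} ->
  expect f h - expect g h <= C.
Proof.
move=> [f0 fX f1] [g0 gX g1] hC.
have cp : is_coupling f g (fun u => f u.1 * g u.2).
  split=> [u|s|t] /=; first by rewrite mulr_ge0.
    by rewrite -mulr_sumr g1 mulr1.
  by rewrite -mulr_suml f1 mul1r.
apply: le_trans (coupling_expect_le cp fX gX hC) _.
rewrite /expect -mulr_suml -(pair_bigA _ (fun s t => f s * g t)) /=.
under eq_bigr do rewrite -mulr_sumr g1 mulr1.
by rewrite f1 mul1r.
Qed.

Lemma is_dist_subset X (Y : {set T}) f : X \subset Y -> is_dist X f -> is_dist Y f.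
Proof.
move=> /subsetP XY [f0 fX f1]; split=> // t tY.
by apply: fX; apply: contra tY => /XY.
Qed.

(** The two laws are compared through the Wasserstein distance W, the supremum
    of the gap between their expectations over the functions that are
    1-Lipschitz on X. Contraction of P and the bound delta on the one-step
    discrepancy give W <= delta + kappa * W, and W is finite because d is
    bounded. *)
Lemma stationary_perturbation X (d : T -> T -> R) (kappa delta C : R)
    (P Q : T -> T -> R) (mu nu : T -> R) h :
    0 < kappa < 1 ->
    {in X &, forall s t, d s t <= C} ->
    is_dist X mu -> is_dist X nu ->
    (forall s, s \in X -> is_dist X (P s)) ->
    (forall g, \sum_s mu s * expect (P s) g = expect mu g) ->
    (forall g, \sum_s nu s * expect (Q s) g = expect nu g) ->
    {in X &, forall s t, exists2 c : T * T -> R, is_coupling (P s) (P t) c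
      & expect c (fun u => d u.1 u.2) <= kappa * d s t} ->
    (forall g, {in X &, forall s t, g s - g t <= d s t} ->
      forall s, nu s != 0 -> expect (Q s) g - expect (P s) g <= delta) ->
    {in X &, forall s t, h s - h t <= d s t} ->
  expect nu h - expect mu h <= delta / (1 - kappa).
Proof.
move=> /andP[k0 k1] dC muX nuX PX muP nuQ contr QP hlip.
pose lip g := {in X &, forall s t, g s - g t <= d s t}.
pose gaps : classical_sets.set R :=
  fun r => exists2 g, lip g & r = expect nu g - expect mu g.
have gapsC r : gaps r -> r <= C.
  move=> [g glip ->]; apply: (expect_oscillation_le nuX muX) => s t sX tX.
  by apply: le_trans (glip _ _ sX tX) (dC _ _ sX tX).
have gaps0 : classical_sets.nonempty gaps by exists (expect nu h - expect mu h), h.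
have gapsub : classical_sets.has_ubound gaps by exists C.
have le_sup g : lip g -> expect nu g - expect mu g <= sup gaps.
  by move=> glip; apply: ub_le_sup => //; exists g.
have nu_ge0 s : 0 <= nu s by case: nuX.
have nu1 : \sum_s nu s = 1 by case: nuX.
have sup_step : sup gaps <= delta + kappa * sup gaps.
  apply: ge_sup => // _ [g glip ->].
  pose Pg s := expect (P s) g.
  have Pglip : lip (fun s => kappa^-1 * Pg s).
    move=> s t sX tX; have [c cc cd] := contr _ _ sX tX.
    rewrite -mulrBr mulrC ler_pdivrMr // [leRHS]mulrC.
    apply: le_trans cd; apply: (coupling_expect_le cc _ _ glip).
      by case: (PX _ sX).
    by case: (PX _ tX).
  have -> : expect nu g - expect mu g =
      (expect nu g - expect nu Pg) + (expect nu Pg - expect mu Pg).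
    by rewrite addrA subrK -(muP g).
  apply: lerD.
    rewrite -(nuQ g) /expect -sumrB -[leRHS]mul1r -nu1 mulr_suml.
    apply: ler_sum => s _; rewrite -mulrBr.
    have [->|nus] := eqVneq (nu s) 0; first by rewrite !mul0r.
    by apply: ler_wpM2l => //; apply: QP.
  have := le_sup _ Pglip; rewrite !expectZ -mulrBr mulrC.
  by rewrite ler_pdivrMr // mulrC.
apply: le_trans (le_sup _ hlip) _.
rewrite ler_pdivlMr ?subr_gt0 //.
by rewrite mulrBr mulr1 lerBlDr [sup _ * _]mulrC.
Qed.

End Expectation.

(** * Eigenvalues and absolute row sums *)

(** An eigenvalue is witnessed by a row vector v with v *m A = lambda *: v, so
    the l1 norm of v is the one controlled by the row sums of A. *)
Lemma eigenvalue_le_row_sum (F : realFieldType) n (A : 'M[F]_n) (lambda eta : F) :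
    (forall i, \sum_j `|A i j| <= eta) -> eigenvalue A lambda -> lambda <= eta.
Proof.
move=> rowA /eigenvalueP[v vA v0].
have vpos : 0 < \sum_i `|v ord0 i|.
  rewrite lt_def sumr_ge0 ?andbT => [|i _]; last exact: normr_ge0.
  apply: contra v0; rewrite psumr_eq0 => [/allP v0|i _]; last exact: normr_ge0.
  apply/eqP/rowP => i; rewrite mxE.
  by have := v0 i; rewrite mem_index_enum normr_eq0 => /(_ isT)/eqP.
apply: le_trans (ler_norm lambda) _.
rewrite -(ler_pM2r vpos) mulr_sumr.
have -> : \sum_i `|lambda| * `|v ord0 i| = \sum_j `|\sum_i v ord0 i * A i j|.
  apply: eq_bigr => j _; rewrite -normrM.
  by have /rowP/(_ j) := vA; rewrite !mxE => ->.
apply: (@le_trans _ _ (\sum_j \sum_i `|v ord0 i| * `|A i j|)).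
  apply: ler_sum => j _; apply: le_trans (ler_norm_sum _ _ _) _.
  by apply: ler_sum => i _; rewrite normrM.
rewrite exchange_big mulr_sumr; apply: ler_sum => i _ /=.
by rewrite -mulr_sumr mulrC ler_wpM2r.
Qed.

(** * Pinned Gibbs distributions *)

Section Pinning.
Variables (R : realType) (q : nat) (V W : finType) (S : spin_system R q V W).
Implicit Types (tau : partial_config q V) (s t : config q V).

Lemma weight_ge0 s : 0 <= weight S s.
Proof.
rewrite /weight !mulr_ge0 ?prodr_ge0 // => [e /andP[h _]|e h|x _].
- exact: interaction_ge0.
- exact: binteraction_ge0.
- exact: field_at_ge0.
Qed.

Lemma gibbs_ge0 s : 0 <= gibbs S s.
Proof. by rewrite divr_ge0 ?weight_ge0 // sumr_ge0 // => t _; apply: weight_ge0. Qed.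

Lemma gibbs_notin_Omega s : s \notin Omega S -> gibbs S s = 0.
Proof.
rewrite inE -leNgt => h; rewrite /gibbs.
have -> : weight S s = 0 by apply/eqP; rewrite eq_le h weight_ge0.
by rewrite mul0r.
Qed.

Lemma gibbs_gt0 s : s \in Omega S -> 0 < gibbs S s.
Proof.
rewrite inE => ws; rewrite divr_gt0 // (bigD1 s) //=.
by rewrite ltr_wpDr // sumr_ge0 // => t _; apply: weight_ge0.
Qed.

Lemma Pr_extends_gt0 tau : pinning S tau -> 0 < Pr (gibbs S) (extends tau).
Proof.
case/set0Pn => s; rewrite inE => /andP[sO st].
rewrite /Pr (bigD1 s) //= ltr_wpDr ?gibbs_gt0 //.
by rewrite sumr_ge0 // => t _; apply: gibbs_ge0.
Qed.

Lemma gibbs_pin_dist tau :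
  pinning S tau -> is_dist (Omega_pin S tau) (gibbs_pin S tau).
Proof.
move=> ptau; have Z0 := Pr_extends_gt0 ptau.
split=> [s|s|]; rewrite /gibbs_pin /cond.
- by rewrite divr_ge0 ?(ltW Z0) //; case: ifP => // _; apply: gibbs_ge0.
- rewrite inE negb_and; case: (extends tau s); rewrite ?orbF /= ?mul0r //.
  by move/gibbs_notin_Omega ->; rewrite mul0r.
- by rewrite -mulr_suml -big_mkcond divff // gt_eqF.
Qed.

Lemma step_stationary_expect (P : select_update S) tau g : pinning S tau ->
  \sum_s gibbs_pin S tau s * expect (step P tau s) g = expect (gibbs_pin S tau) g.
Proof.
move=> ptau; have [_ muX _] := gibbs_pin_dist ptau.
rewrite /expect; under eq_bigr do rewrite mulr_sumr.
rewrite exchange_big; apply: eq_bigr => t _ /=.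
under eq_bigr do rewrite mulrA.
rewrite -mulr_suml; congr (_ * _).
rewrite (bigID (mem (Omega_pin S tau))) /= [X in _ + X]big1 ?addr0; last first.
  by move=> s /muX ->; rewrite mul0r.
have [tX|tX] := boolP (t \in Omega_pin S tau).
  exact: step_stationary.
rewrite muX // big1 // => s sX; rewrite /step.
by have [_ /(_ t tX) -> _] := step_dist P ptau sX; rewrite mulr0.
Qed.

(** The pinning tau with the vertex x pinned to the spin a as well. *)
Definition pin_vertex tau (x : V) (a : 'I_q) : partial_config q V :=
  [ffun y => if y == x then Some a else tau y].

Lemma extends_pin_vertex tau x a s : tau x = None ->
  extends (pin_vertex tau x a) s = extends tau s && (s x == a).
Proof.
move=> tx; apply/forallP/andP => [h|[/forallP h /eqP sx] y].
  split; last by have := h x; rewrite ffunE eqxx /= => /eqP[->].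
  apply/forallP => y; have := h y; rewrite ffunE.
  by case: (eqVneq y x) => [->|//]; rewrite tx eqxx.
rewrite ffunE; case: (eqVneq y x) => [->|_]; last exact: h.
by rewrite sx eqxx orbT.
Qed.

Lemma Omega_pin_vertex_subset tau x a : tau x = None ->
  Omega_pin S (pin_vertex tau x a) \subset Omega_pin S tau.
Proof.
move=> tx; apply/subsetP => s; rewrite !inE extends_pin_vertex //.
by case/andP => -> /andP[-> _].
Qed.

Lemma pinning_pin_vertex tau x a :
  (x, a) \in free_spins S tau -> pinning S (pin_vertex tau x a).
Proof.
rewrite inE /= => /andP[/eqP tx /existsP[s /andP[]]].
rewrite inE => /andP[sO st] sx; apply/set0Pn; exists s.
by rewrite inE sO extends_pin_vertex // st sx.
Qed.

Lemma cond_gibbs_pin tau x a : pinning S tau -> tau x = None ->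
  cond (gibbs_pin S tau) (fun s => s x == a) =1 gibbs_pin S (pin_vertex tau x a).
Proof.
move=> ptau tx s; have Z0 := Pr_extends_gt0 ptau.
rewrite /gibbs_pin /cond.
have -> : Pr (fun t => (if extends tau t then gibbs S t else 0)
      / Pr (gibbs S) (extends tau)) (fun s => s x == a) =
    Pr (gibbs S) (extends (pin_vertex tau x a)) / Pr (gibbs S) (extends tau).
  rewrite {1}/Pr -mulr_suml; congr (_ / _).
  rewrite -big_mkcondr /Pr; apply: eq_bigl => t.
  by rewrite extends_pin_vertex // andbC.
rewrite extends_pin_vertex //.
case: (s x == a); rewrite ?andbF ?mul0r // andbT.
by rewrite invf_div mulrA divfK // gt_eqF.
Qed.

Lemma restrict_pin_vertex tau x a (B : {set V}) : x \notin B ->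
  restrict (pin_vertex tau x a) B = restrict tau B.
Proof.
move=> xB; apply/ffunP => y; rewrite !ffunE; case: ifP => // yB.
by case: eqP => // yx; rewrite yx (negPf xB) in yB.
Qed.

Lemma hamming_agree_off (B : {set V}) s t u :
  t \in agree_off B s -> u \in agree_off B s -> (hamming t u <= #|B|)%N.
Proof.
rewrite !inE => /forallP ts /forallP us.
apply/subset_leq_card/subsetP => y; rewrite inE; apply: contraR => yB.
by have := ts y; have := us y; rewrite yB /= => /eqP-> /eqP->.
Qed.

Lemma select_le_max (P : select_update S) s x : s \in Omega S ->
  \sum_(B in blocks P | x \in B) select P s B <= max_select_prob P.
Proof.
move=> sO; rewrite /max_select_prob.
by apply: le_trans (le_bigmax_cond _ _ sO); apply: le_bigmax.
Qed.

Lemma expect_step (P : select_update S) tau s g :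
  expect (step P tau s) g =
  \sum_(B in blocks P) select P s B * expect (update P B s (restrict tau B)) g.
Proof.
rewrite /expect /step /step_of; under eq_bigr do rewrite mulr_suml.
rewrite exchange_big; apply: eq_bigr => B _; rewrite mulr_sumr.
by apply: eq_bigr => t _; rewrite mulrA.
Qed.

(** A block that can be selected is updated within the configurations that are
    both compatible with the pinning and unchanged off the block. *)
Lemma update_dist_pin (P : select_update S) tau s (B : {set V}) :
    pinning S tau -> s \in Omega_pin S tau -> B \in blocks P ->
    0 < select P s B ->
  is_dist (Omega_pin S tau :&: agree_off B s) (update P B s (restrict tau B)).
Proof.
move=> ptau sX BP selB; have [u0 uB u1] := update_dist ptau sX BP.
split=> // t; rewrite inE negb_and => /orP[tX|]; last exact: uB.
have sO : s \in Omega S by move: sX; rewrite inE => /andP[].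
have [sel0 _ _] := select_dist P sO.
have [_ /(_ t tX)/eqP + _] := step_dist P ptau sX.
rewrite /step_of psumr_eq0; last first.
  move=> C CP; rewrite mulr_ge0 //.
  by have [] := update_dist ptau sX CP.
move=> /allP/(_ B); rewrite mem_index_enum BP mulf_eq0 gt_eqF //=.
by move=> /(_ isT)/eqP.
Qed.

(** Pinning one more vertex x affects a step only when the selected block
    contains x, and then the outcomes differ on that block at most. *)
Lemma step_pin_vertex_le (P : select_update S) tau x a s (L : R)
    (g : config q V -> R) :
    0 <= L -> pinning S tau -> pinning S (pin_vertex tau x a) -> tau x = None ->
    s \in Omega_pin S (pin_vertex tau x a) ->
    {in Omega_pin S tau &, forall t u, g t - g u <= L * (hamming t u)%:R} ->
  expect (step P (pin_vertex tau x a) s) g - expect (step P tau s) g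
    <= L * (max_select_prob P * (max_block_size P)%:R).
Proof.
move=> L0 ptau ptau' tx sX' glip.
have sub := @Omega_pin_vertex_subset tau x a tx.
have sX := subsetP sub _ sX'.
have sO : s \in Omega S by move: sX; rewrite inE => /andP[].
have [sel0 _ _] := select_dist P sO.
have block_le B : B \in blocks P ->
    select P s B * expect (update P B s (restrict (pin_vertex tau x a) B)) g
    - select P s B * expect (update P B s (restrict tau B)) g
    <= if x \in B then select P s B * (L * (max_block_size P)%:R) else 0.
  move=> BP; rewrite -mulrBr.
  case: ifPn => [xB|/restrict_pin_vertex ->]; last by rewrite subrr mulr0.
  have [->|selB] := eqVneq (select P s B) 0; first by rewrite !mul0r.
  apply: ler_wpM2l => //.
  have {}selB : 0 < select P s B by rewrite lt_def selB sel0.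
  apply: (@expect_oscillation_le _ _ (Omega_pin S tau :&: agree_off B s)).
  - apply: is_dist_subset (update_dist_pin ptau' sX' BP selB).
    exact: setSI.
  - exact: update_dist_pin.
  move=> t u /setIP[tX tB] /setIP[uX uB].
  apply: le_trans (glip _ _ tX uX) _.
  apply: ler_wpM2l => //; rewrite ler_nat.
  by apply: leq_trans (hamming_agree_off tB uB) _; apply: leq_bigmax_cond.
rewrite !expect_step -sumrB.
apply: le_trans (ler_sum _ block_le) _.
rewrite -big_mkcondr -mulr_suml mulrCA.
by apply: ler_wpM2l => //; apply: ler_wpM2r; rewrite ?select_le_max.
Qed.

(** A combination of the indicators of the events s y = b with coefficients of
    absolute value at most 1 is 2-Lipschitz for the Hamming distance: changing
    the spin at one vertex affects two indicators. *)
Lemma indicator_sum_lipschitz (c : V * 'I_q -> R) s t :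
    (forall u, `|c u| <= 1) ->
  \sum_u c u * (s u.1 == u.2)%:R - \sum_u c u * (t u.1 == u.2)%:R
    <= 2 * (hamming s t)%:R.
Proof.
move=> c1; rewrite -sumrB.
apply: (@le_trans _ _
  (\sum_(u : V * 'I_q) `|(s u.1 == u.2)%:R - (t u.1 == u.2)%:R : R|)).
  apply: ler_sum => u _; rewrite -mulrBr; apply: le_trans (ler_norm _) _.
  by rewrite normrM ler_piMl.
rewrite -(pair_bigA _ (fun y b => `|(s y == b)%:R - (t y == b)%:R : R|)) /=.
rewrite /hamming -sum1_card natr_sum mulr_sumr [leRHS]big_mkcond.
apply: ler_sum => y _; rewrite inE mulr1.
case: eqVneq => [->|sty] /=; first by rewrite big1 // => b _; rewrite subrr normr0.
apply: (@le_trans _ _ (\sum_b ((s y == b)%:R + (t y == b)%:R : R))).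
  apply: ler_sum => b _; apply: le_trans (ler_normB _ _) _.
  by rewrite !normr_nat.
have ind1 (z : 'I_q) : \sum_b (z == b)%:R = 1 :> R.
  rewrite (bigD1 z) //= eqxx big1 ?addr0 // => b.
  by rewrite eq_sym => /negPf ->.
by rewrite big_split /= !ind1.
Qed.

End Pinning.

Theorem theorem1p11 (R : realType) (q : nat) (hq : (2 <= q)%N) (V W : finType)
    (S : spin_system R q V W) (hOmega : Omega S != set0)
    (hconn : totally_connected S) (kappa gamma : R)
    (hkappa : 0 < kappa < 1) (hgamma : 1 <= gamma)
    (P : select_update S) (d : config q V -> config q V -> R)
    (hd : equivalent_metric S gamma d) (hcontr : contractive kappa P d) :
  spectrally_independent S
    (2 * gamma ^+ 2 * max_select_prob P * (max_block_size P)%:R / (1 - kappa)).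
Proof.
move=> tau ptau lambda; apply: eigenvalue_le_row_sum => i.
have := enum_valP i; case ei : (enum_val i) => [x a] xa.
have tx : tau x = None by move: xa; rewrite inE /= => /andP[/eqP].
have ptau' := pinning_pin_vertex xa.
have g0 : 0 < gamma by apply: lt_le_trans hgamma.
have [_ dH] := hd.
have subO : {subset Omega_pin S tau <= Omega S}.
  by move=> s; rewrite inE => /andP[].
pose mu := gibbs_pin S tau; pose nu := gibbs_pin S (pin_vertex tau x a).
(* The test function whose expectation gap is the absolute row sum. *)
pose c u : R := Num.sg (influence S tau (x, a) u).
pose f (s : config q V) : R := \sum_u c u * (s u.1 == u.2)%:R.
have c1 u : `|c u| <= 1 by rewrite /c normr_sg lern1; case: (_ == _).
have row_le : \sum_j `|influence_mx S tau i j| <= expect nu f - expect mu f.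
  rewrite !expect_sum -sumrB.
  have -> : \sum_j `|influence_mx S tau i j| =
      \sum_(u in free_spins S tau) `|influence S tau (x, a) u|.
    rewrite (big_enum_val (fun u => `|influence S tau (x, a) u|)).
    by apply: eq_bigr => j _; rewrite mxE ei.
  rewrite big_mkcond; apply: ler_sum => u _.
  apply: (@le_trans _ _ `|influence S tau (x, a) u|); first by case: ifP.
  rewrite !expectZ -mulrBr !expect_indicator normrEsg -/(c u).
  rewrite /c /influence /=; case: eqP => [_|_]; first by rewrite sgr0 !mul0r.
  rewrite (_ : Pr (cond _ _) _ = Pr nu (fun s => s u.1 == u.2)) //.
  by apply: eq_bigr => s _; rewrite cond_gibbs_pin.
apply: le_trans row_le _.
have flip : {in Omega_pin S tau &, forall s t,
    (2 * gamma)^-1 * f s - (2 * gamma)^-1 * f t <= d s t}.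
  move=> s t sX tX; rewrite -mulrBr mulrC ler_pdivrMr ?mulr_gt0 //.
  apply: le_trans (indicator_sum_lipschitz s t c1) _.
  rewrite mulrCA; apply: ler_wpM2l => //.
  have /andP[+ _] := dH _ _ (subO _ sX) (subO _ tX).
  by rewrite mulrC ler_pdivrMr.
have gap : expect nu (fun s => (2 * gamma)^-1 * f s)
    - expect mu (fun s => (2 * gamma)^-1 * f s)
    <= gamma * (max_select_prob P * (max_block_size P)%:R) / (1 - kappa).
  apply: (@stationary_perturbation _ _ (Omega_pin S tau) d kappa _
    (gamma * #|V|%:R) (step P tau) (step P (pin_vertex tau x a))) => //.
  - move=> s t sX tX; have /andP[_ h] := dH _ _ (subO _ sX) (subO _ tX).
    by apply: le_trans h _; rewrite ler_pM2l // ler_nat max_card.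
  - exact: gibbs_pin_dist.
  - by apply: is_dist_subset (gibbs_pin_dist ptau'); apply: Omega_pin_vertex_subset.
  - by move=> s sX; apply: step_dist.
  - by move=> g; apply: step_stationary_expect.
  - by move=> g; apply: step_stationary_expect.
  - exact: hcontr.
  move=> g glip s nus; apply: step_pin_vertex_le => //; first exact: ltW.
    have [_ nuX _] := gibbs_pin_dist ptau'.
    by apply: contraR nus => /nuX nus0; rewrite /nu nus0.
  move=> t u tX uX; apply: le_trans (glip _ _ tX uX) _.
  by have /andP[] := dH _ _ (subO _ tX) (subO _ uX).
move: gap; rewrite !expectZ -mulrBr mulrC ler_pdivrMr ?mulr_gt0 //.
move/le_trans; apply; rewrite [leLHS]mulrAC.
by rewrite [_ * (2 * gamma)]mulrC expr2 -!mulrA.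
Qed.
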